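(* For every non-negative integer $d$ there is a constant $c = c(d)$, depending only on $d$, such that for every $n$ and every graph $G$ with maximum degree $d$ on $n$ vertices there is a graph $H$ with $|E(H)| \leq cn$ such that, in the $G$-game played on the edges of $H$, Maker has a strategy to occupy a copy of $G$ (i.e. Maker has a winning strategy).
   Context: All graphs are finite and simple. Let $G$ and $H$ be graphs. In the $G$-game on the board $H$, two players, Maker and Breaker, take turns, each claiming one previously unclaimed edge of $H$ per turn, with Maker going first, until all edges of $H$ are claimed. Maker's graph is the graph on $V(H)$ whose edges are the edges claimed by Maker. Maker wins if, after all edges of $H$ have been claimed, Maker's graph contains a copy of $G$ as a (not necessarily induced) subgraph; otherwise Breaker wins. *)

(* Defs.v *)
From mathcomp Require Import all_boot.

Set Implicit Arguments.
Unset Strict Implicit.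
Unset Printing Implicit Defensive.

Record sgraph := SGraph {
  vert :> finType;
  adj : rel vert;
  adj_sym : symmetric adj;
  adj_irr : irreflexive adj
}.

Definition edges (G : sgraph) : {set {set G}} :=
  [set [set u.1; u.2] | u : G * G & adj u.1 u.2].

Definition degree (G : sgraph) (x : G) : nat := #|[set y : G | adj x y]|.

Definition max_degree (G : sgraph) : nat := \max_(x : G) degree x.

(* Not necessarily induced: non-edges of G may be mapped to edges of H. *)
Definition contains_copy (H G : sgraph) : Prop :=
  exists2 f : G -> H, injective f & forall x y : G, adj x y -> adj (f x) (f y).

Section EdgeSetGraph.
Variables (V : finType) (E : {set {set V}}).

(* The test x != y discards a possible singleton in E. *)
Definition edge_set_adj : rel V := fun x y => (x != y) && ([set x; y] \in E).

Lemma edge_set_adj_sym : symmetric edge_set_adj.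
Proof. by move=> x y; rewrite /edge_set_adj eq_sym setUC. Qed.

Lemma edge_set_adj_irr : irreflexive edge_set_adj.
Proof. by move=> x; rewrite /edge_set_adj eqxx. Qed.

Definition edge_set_graph : sgraph :=
  SGraph edge_set_adj_sym edge_set_adj_irr.
End EdgeSetGraph.

Section Game.
Variable H : sgraph.

(* A play, finished or not, is the list of the edges claimed so far in
   chronological order. Positions are counted from 0 and Maker goes first, so
   Maker claims the edges at even positions. *)
Definition is_play (p : seq {set H}) : Prop :=
  uniq p /\ {subset p <= edges H}.

Definition is_complete_play (p : seq {set H}) : Prop :=
  uniq p /\ p =i edges H.

Definition maker_edges (p : seq {set H}) : {set {set H}} :=
  [set e | (e \in p) && ~~ odd (index e p)].

Definition maker_graph (p : seq {set H}) : sgraph :=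
  edge_set_graph (maker_edges p).

(* Without this requirement a strategy proposing illegal moves would be
   compatible with no complete play, and hence vacuously winning. *)
Definition legal_maker_strategy (s : seq {set H} -> {set H}) : Prop :=
  forall p : seq {set H}, is_play p -> ~~ odd (size p) -> size p < #|edges H| ->
    s p \in edges H /\ s p \notin p.

Definition follows (s : seq {set H} -> {set H}) (p : seq {set H}) : Prop :=
  forall i : nat, i < size p -> ~~ odd i -> nth set0 p i = s (take i p).

Definition maker_wins (G : sgraph) : Prop :=
  exists2 s : seq {set H} -> {set H}, legal_maker_strategy s &
    forall p : seq {set H}, is_complete_play p -> follows s p ->
      contains_copy (maker_graph p) G.
End Game.

(* Main.v *)
Require Import Defs.
From mathcomp Require Import all_boot.
From mathcomp Require Import zify.

(** The board is the blow-up of [G] in which every vertex [u] becomes a class of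
[K] vertices and every edge a complete bipartite graph between two classes,
where [K] depends on [d] only; it has at most [K * K * d * n] edges. Maker
looks for a copy of [G] with one vertex in each class.

The edges of the board over one edge [uw] of [G] form a zone of bounded size.
When Breaker plays in a zone, Maker answers in the same zone with the
Erdos-Selfridge strategy, so that she claims an edge of every complete
bipartite [m] by [m] subgraph of every zone ([maker_hits],
[maker_hits_bicliques]). The condition for this, [2 * 'C(2 * K, m) ^ 2 < 2 ^ (m * m)],
concerns a single zone and not the whole board, which is why [K] can be
bounded independently of [n]; it holds as soon as [m] is large and [K] is
polynomial in [m] ([scale_exists]).

A Maker graph with this property contains the copy ([greedy_embedding]). The
vertices of [G] are embedded one at a time, and each vertex [w] not yet
embedded keeps the set of the vertices of its class that are joined to the
images of all its embedded neighbours. Given a candidate set [C] of [w] with at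
least [m * s.+1] elements, fewer than [m] vertices of the class of a neighbour
[u] have fewer than [s] neighbours in [C]: deleting from [C] the
neighbourhoods of [m] such vertices would leave [m] elements, hence an [m] by
[m] subgraph without Maker edge. A good choice for the image of [u] thus
divides the candidate sets of its neighbours by about [m]. This happens at most
[d] times to each of them, so a class of [m ^ (2 * d + 2)] vertices is enough.
As different vertices of [G] have disjoint classes, injectivity is free. *)

Set Implicit Arguments.
Unset Strict Implicit.
Unset Printing Implicit Defensive.

(** * The potential of a zoned hypergraph *)

(** Maker wants to meet every set of the families [F i]. The sets of [F i] live
in zone [i], so a move changes the potential of one zone only. *)
Section Potential.
Variables (T I : finType) (X : {set T}) (zone : T -> I).
Variables (F : I -> {set {set T}}) (L : nat).
Hypothesis zoneP : forall i A x, A \in F i -> x \in A -> zone x = i.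
Implicit Types (i : I) (M B A : {set T}) (e f g : T).

(** The Erdos-Selfridge potential, scaled so that a set of size [L] taken
entirely by Breaker contributes [2 ^ L]. *)
Definition danger i M B : nat :=
  \sum_(A in F i | [disjoint A & M]) 2 ^ #|A :&: B|.

(** The share of the sets through [e] in the potential: what Maker removes by
claiming [e], and what Breaker adds by claiming it. *)
Definition mass i M B e : nat :=
  \sum_(A in F i | [disjoint A & M]) if e \in A then 2 ^ #|A :&: B| else 0.

Definition safe M B : bool := [forall i, danger i M B < 2 ^ L].

Definition free M B : {set T} := X :\: (M :|: B).

(** The invariant after a move of Maker. The zone Breaker enters next is
unknown, so every zone has to stay safe after any single move of Breaker. *)
Definition robust M B : bool :=
  safe M B && [forall e in free M B, safe M (e |: B)].

Lemma cardsIU1_le A B e : #|A :&: (e |: B)| <= (e \in A) + #|A :&: B|.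
Proof.
rewrite setIUr; apply: leq_trans (leq_card_setU _ _) _.
rewrite leq_add2r; case: (boolP (e \in A)) => eA.
  by apply: leq_trans (subset_leq_card (subsetIr _ _)) _; rewrite cards1.
rewrite leqn0 cards_eq0 -subset0; apply/subsetP=> x.
by rewrite !inE => /andP[xA /eqP xe]; rewrite -xe xA in eA.
Qed.

Lemma disjointsU1 A M f :
  [disjoint A & f |: M] = (f \notin A) && [disjoint A & M].
Proof.
rewrite ![[disjoint A & _]]disjoint_sym; rewrite disjoints_subset subUset.
by rewrite sub1set inE -disjoints_subset.
Qed.

Lemma danger_maker_le i M B f : danger i (f |: M) B <= danger i M B.
Proof.
rewrite /danger [leqLHS]big_mkcondr [leqRHS]big_mkcondr /=.
apply: leq_sum => A _; rewrite disjointsU1.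
by case: (f \notin A); case: ifP.
Qed.

Lemma safe_maker M B f : safe M B -> safe (f |: M) B.
Proof.
move=> /forallP sMB; apply/forallP=> i.
exact: leq_ltn_trans (danger_maker_le i M B f) (sMB i).
Qed.

Lemma danger_other_zone i M B e :
  zone e != i -> danger i M (e |: B) = danger i M B.
Proof.
move=> ze; apply: eq_bigr => A /andP[AF _]; congr (2 ^ #|pred_of_set _|).
apply/setP=> x; rewrite !inE; case: eqP => [->|] //=.
by case: (boolP (e \in A)) => // /(zoneP AF) ze'; rewrite ze' eqxx in ze.
Qed.

(** Claiming [f] costs Breaker [mass f], and the move [g] then regains at most
[mass g]; it may regain less, since sets through both [f] and [g] are already
met. *)
Lemma danger_exchange i M B f g :
  mass i M B g <= mass i M B f -> danger i (f |: M) (g |: B) <= danger i M B.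
Proof.
move=> le_gf; rewrite -(leq_add2r (mass i M B f)).
apply: (@leq_trans (danger i M B + mass i M B g)); last by rewrite leq_add2l.
rewrite /danger /mass -big_split /=.
have -> : \sum_(A in F i | [disjoint A & f |: M]) 2 ^ #|A :&: (g |: B)|
   = \sum_(A in F i | [disjoint A & M])
       if f \in A then 0 else 2 ^ #|A :&: (g |: B)|.
  rewrite [LHS]big_mkcondr [RHS]big_mkcondr /=; apply: eq_bigr => A _.
  by rewrite disjointsU1; case: (f \in A); case: [disjoint A & M].
rewrite -big_split /=; apply: leq_sum => A _.
have := cardsIU1_le A B g; rewrite -(leq_exp2l (m := 2)) // expnD.
by case: (f \in A); case: (g \in A) => /=; lia.
Qed.

Lemma robust_maker M B f : robust M B -> robust (f |: M) B.
Proof.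
case/andP=> sMB /forall_inP rMB; apply/andP; split; first exact: safe_maker.
apply/forall_inP=> e; rewrite !inE => eX; apply/safe_maker/rMB.
by rewrite !inE; move: eX; case: (e == f).
Qed.

(** Maker answers [e] with the edge of largest mass in the zone of [e]. By
[danger_exchange] no further move of Breaker in that zone exceeds the
potential reached just after [e]; in the other zones nothing has changed to
Breaker's advantage since the last move of Maker. *)
Lemma robust_answer M B e :
  robust M B -> e \in free M B -> free M (e |: B) != set0 ->
  exists2 f, f \in free M (e |: B) & robust (f |: M) (e |: B).
Proof.
case/andP=> sMB /forall_inP rMB eF /set0Pn[f0 f0F].
have sMeB := rMB e eF.
(* If no free edge is left in the zone of e, all masses vanish and the maximum
   is attained at an arbitrary free edge, which is harmless. *)
case: (@arg_maxnP _ f0 (mem (free M (e |: B))) (mass (zone e) M (e |: B)) f0F).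
move=> f fF fmax; exists f => //.
apply/andP; split; first exact: safe_maker.
apply/forall_inP=> g gF; apply/forallP=> i.
have gF' : g \in free M (e |: B).
  by move: gF; rewrite !inE; case: (g == f).
have gF0 : g \in free M B.
  by move: gF'; rewrite !inE; case: (g == e); rewrite ?orbT.
have [zei|nzei] := eqVneq (zone e) i; last first.
  rewrite setUCA danger_other_zone //.
  apply: leq_ltn_trans (danger_maker_le _ _ _ _) _.
  exact: (forallP (rMB g gF0)).
apply: leq_ltn_trans (forallP sMeB i).
by apply: danger_exchange; rewrite -zei; apply: fmax.
Qed.

(** One move of Breaker at most doubles the weight of each set; this is where
the factor [2] comes from. *)
Lemma robust_start : (forall i, 2 * #|F i| < 2 ^ L) -> robust set0 set0.
Proof.
move=> cF.
have dle B : #|B| <= 1 -> safe set0 B.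
  move=> B1; apply/forallP=> i; apply: leq_ltn_trans (cF i).
  rewrite mulnC -sum_nat_const /danger [leqLHS]big_mkcondr /=.
  apply: leq_sum => A _; case: ifP => // _.
  rewrite -[leqRHS](expn1 2) leq_exp2l //.
  by apply: leq_trans B1; rewrite subset_leq_card // subsetIr.
apply/andP; split; first by rewrite dle ?cards0.
by apply/forall_inP=> e _; rewrite dle // setU0 cards1.
Qed.

(** At the end a set missed by Maker is all Breaker's, and its weight alone
violates the bound. *)
Lemma safe_hits M B i A :
  safe M B -> X \subset M :|: B -> A \in F i -> A \subset X -> L <= #|A| ->
  exists2 e, e \in A & e \in M.
Proof.
move=> /forallP/(_ i) sMB XMB AF AX LA.
have [dAM|] := boolP [disjoint A & M]; last first.
  by case/pred0Pn=> e /andP[eA eM]; exists e.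
have AB : A :&: B = A.
  apply/setIidPl/subsetP=> x xA.
  have := subsetP XMB x (subsetP AX x xA); rewrite inE => /orP[xM|//].
  by rewrite (disjointFr dAM xA) in xM.
move: sMB; rewrite ltnNge /danger (bigD1 A) /= ?AF // AB => /negP[].
by apply: leq_trans (leq_addr _ _); rewrite leq_exp2l.
Qed.

End Potential.

(** * Maker's strategy *)

Section GameOfZones.
Variables (H : sgraph) (I : finType) (zone : {set H} -> I).
Variables (F : I -> {set {set {set H}}}) (L : nat).
Hypothesis zoneP : forall i A x, A \in F i -> x \in A -> zone x = i.
Implicit Types (p : seq {set H}) (e f : {set H}).

Definition breaker_edges p : {set {set H}} :=
  [set e | (e \in p) && odd (index e p)].

Lemma claimedE p : maker_edges p :|: breaker_edges p = [set e in p].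
Proof. by apply/setP=> e; rewrite !inE -andb_orr orNb andbT. Qed.

Lemma index_rcons p e x :
  index x (rcons p e) = if x \in p then index x p else size p + (x != e).
Proof.
rewrite -cats1 index_cat /= eq_sym.
by case: ifP => //; case: (x == e).
Qed.

Lemma maker_edges_rcons p e : e \notin p ->
  maker_edges (rcons p e) =
    if odd (size p) then maker_edges p else e |: maker_edges p.
Proof.
move=> ep; apply/setP=> x.
rewrite /maker_edges inE index_rcons mem_rcons inE.
case: (eqVneq x e) => [->|xe] /=.
  rewrite (negbTE ep) addn0.
  by case: (odd (size p)); rewrite !inE ?eqxx ?(negbTE ep).
by case: (odd (size p)); rewrite !inE ?(negbTE xe) /=; case: ifP.
Qed.

Lemma breaker_edges_rcons p e : e \notin p ->
  breaker_edges (rcons p e) =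
    if odd (size p) then e |: breaker_edges p else breaker_edges p.
Proof.
move=> ep; apply/setP=> x.
rewrite /breaker_edges inE index_rcons mem_rcons inE.
case: (eqVneq x e) => [->|xe] /=.
  rewrite (negbTE ep) addn0.
  by case: (odd (size p)); rewrite !inE ?eqxx ?(negbTE ep).
by case: (odd (size p)); rewrite !inE ?(negbTE xe) /=; case: ifP.
Qed.

Let unclaimed p : {set {set H}} := edges H :\: [set e in p].
Let good p e : bool :=
  robust (edges H) F L (e |: maker_edges p) (breaker_edges p).

Lemma unclaimed_neq0 p :
  is_play p -> size p < #|edges H| -> unclaimed p != set0.
Proof.
move=> [up _] sp; apply: contraL sp; rewrite setD_eq0 -leqNgt => /subset_leq_card.
by rewrite cardsE (card_uniqP up).
Qed.

(** The strategy does not refer to Breaker's last move: any move restoring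
[robust] will do. The second choice keeps the strategy legal on plays that it
does not produce. *)
Definition zone_strategy p : {set H} :=
  if [pick e in unclaimed p | good p e] is Some e then e
  else odflt set0 [pick e in unclaimed p].

Lemma zone_strategy_legal : legal_maker_strategy zone_strategy.
Proof.
move=> p pp _ sp; suff: zone_strategy p \in unclaimed p.
  by rewrite !inE => /andP[].
rewrite /zone_strategy; case: pickP => [e /andP[]//|_].
case: pickP => //= no; case/set0Pn: (unclaimed_neq0 pp sp) => e.
by have := no e; rewrite /= => ->.
Qed.

(** The existence of a good move cannot be left to [robust_answer] when it is
needed, because that lemma speaks of the position before Breaker's move; so
it is part of the invariant for positions with Maker to play. *)
Let invariant p : Prop :=
  if odd (size p) then
    is_true (robust (edges H) F L (maker_edges p) (breaker_edges p))
  else safe F L (maker_edges p) (breaker_edges p) /\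
       (unclaimed p != set0 -> exists2 e, e \in unclaimed p & good p e).

Hypothesis F_small : forall i, 2 * #|F i| < 2 ^ L.

Lemma invariant_nil : invariant [::].
Proof.
have M0 : maker_edges (H := H) [::] = set0 by apply/setP=> x; rewrite !inE.
have B0 : breaker_edges [::] = set0 by apply/setP=> x; rewrite !inE.
have r0 := robust_start (edges H) F_small.
rewrite /invariant /good /= M0 B0; split; first by case/andP: r0.
by case/set0Pn=> e eX; exists e => //; apply: robust_maker.
Qed.

Lemma invariant_rcons p e :
  e \in edges H -> e \notin p -> (~~ odd (size p) -> e = zone_strategy p) ->
  invariant p -> invariant (rcons p e).
Proof.
move=> eX ep es; rewrite /invariant size_rcons /=.
have unE q : unclaimed q = free (edges H) (maker_edges q) (breaker_edges q).
  by rewrite /free claimedE.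
case: (boolP (odd (size p))) es => /= op es.
  rewrite /good maker_edges_rcons // breaker_edges_rcons // op => rp.
  have eF : e \in free (edges H) (maker_edges p) (breaker_edges p).
    by rewrite -unE !inE ep.
  split; first by case/andP: rp => _ /forall_inP; apply.
  rewrite unE maker_edges_rcons // breaker_edges_rcons // op.
  exact: (robust_answer zoneP).
rewrite maker_edges_rcons // breaker_edges_rcons // (negbTE op).
case=> _ []; first by apply/set0Pn; exists e; rewrite !inE ep.
move=> f fF gf; rewrite (es isT) /zone_strategy.
by case: pickP => [x /andP[]//|/(_ f)]; rewrite fF gf.
Qed.

Lemma invariant_follows p :
  is_play p -> follows zone_strategy p -> invariant p.
Proof.
elim/last_ind: p => [|p e IHp] [up sp] fp; first exact: invariant_nil.
move: up; rewrite rcons_uniq => /andP[ep up].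
apply: invariant_rcons => //.
- by apply: sp; rewrite mem_rcons mem_head.
- move=> op; have := fp (size p); rewrite size_rcons ltnSn => /(_ isT op).
  by rewrite nth_rcons ltnn eqxx -cats1 take_size_cat.
apply: IHp; first by split=> // x xp; apply: sp; rewrite mem_rcons inE xp orbT.
move=> i ip oi; have := fp i; rewrite size_rcons ltnS (ltnW ip) => /(_ isT oi).
by rewrite nth_rcons ip -cats1 takel_cat // ltnW.
Qed.

Lemma maker_hits :
  exists2 s : seq {set H} -> {set H}, legal_maker_strategy s &
  forall p, is_complete_play p -> follows s p ->
  forall i A, A \in F i -> A \subset edges H -> L <= #|A| ->
  exists2 e, e \in A & e \in maker_edges p.
Proof.
exists zone_strategy; first exact: zone_strategy_legal.
move=> p [up pX] fp i A AF AX LA.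
have/invariant_follows/(_ fp) : is_play p by split=> // x; rewrite pX.
have XMB : edges H \subset maker_edges p :|: breaker_edges p.
  by rewrite claimedE; apply/subsetP=> x; rewrite inE pX.
have sMB : invariant p -> safe F L (maker_edges p) (breaker_edges p).
  by rewrite /invariant; case: ifP => _; [case/andP | case].
by move/sMB/safe_hits; apply; eassumption.
Qed.

End GameOfZones.

(** * Greedy embedding *)

Lemma card_bigcup_le (I T : finType) (P : pred I) (E : I -> {set T}) :
  #|\bigcup_(i | P i) E i| <= \sum_(i | P i) #|E i|.
Proof.
elim/big_rec2: _ => [|i n B _ le_Bn]; first by rewrite cards0.
by apply: leq_trans (leq_card_setU _ _) _; rewrite leq_add2l.
Qed.

Lemma subset_of_card (T : finType) (A : {set T}) (n : nat) :
  n <= #|A| -> exists2 B : {set T}, B \subset A & #|B| = n.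
Proof.
case/card_geqP=> s [us <- sA]; exists [set x in s].
  by apply/subsetP=> x; rewrite inE; apply: sA.
by rewrite cardsE; apply/card_uniqP.
Qed.

(** [R u w i j] says that the vertices [i] of the class of [u] and [j] of the
class of [w] are joined; [R_hits] is what Maker's strategy provides. *)
Section GreedyEmbedding.
Variables (G : sgraph) (K : finType) (R : G -> G -> rel K) (d m : nat).
Hypothesis R_sym : forall u w i j, R u w i j = R w u j i.
Hypothesis R_hits : forall u w (A B : {set K}),
  adj u w -> #|A| = m -> #|B| = m -> exists i j, [/\ i \in A, j \in B & R u w i j].
Hypothesis deg_le : forall u : G, degree u <= d.
Hypothesis m_gt1 : 1 < m.
Hypothesis m_gtd : d < m.
Implicit Types (u w x y : G) (S : {set G}) (phi : G -> K).

Definition nbrs u w (i : K) : {set K} := [set j | R u w i j].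

(** Otherwise [m] poor vertices have at most [m * s] neighbours in [C]
altogether, and the [m] or more remaining elements of [C] contradict [R_hits]. *)
Lemma few_poor u w (C : {set K}) (s : nat) :
  adj u w -> m * s.+1 <= #|C| -> #|[set i | #|C :&: nbrs u w i| < s]| < m.
Proof.
move=> uw sC; rewrite ltnNge; apply/negP=> /subset_of_card[A /subsetP Apoor Am].
have: m <= #|C :\: \bigcup_(i in A) (C :&: nbrs u w i)|.
  have: \sum_(i in A) #|C :&: nbrs u w i| <= m * s.
    rewrite -Am -sum_nat_const; apply: leq_sum => i /Apoor.
    by rewrite inE => /ltnW.
  have := card_bigcup_le (mem A) (fun i => C :&: nbrs u w i).
  have := cardsID (\bigcup_(i in A) (C :&: nbrs u w i)) C.
  have := subset_leq_card (subsetIr C (\bigcup_(i in A) (C :&: nbrs u w i))).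
  by rewrite /= mulnS in sC *; lia.
case/subset_of_card=> B /subsetP BC Bm.
have [i [j [iA jB Rij]]] := R_hits uw Am Bm.
have := BC j jB; rewrite inE => /andP[/negP njA jC]; apply: njA.
by apply/bigcupP; exists i => //; rewrite !inE jC.
Qed.

Definition cand S phi w : {set K} :=
  [set j | [forall u in S, adj u w ==> R u w (phi u) j]].

Definition rest S w : nat := #|[set x | adj w x] :\: S|.

(** The number of candidates required of a vertex with [k] neighbours still to
be embedded. By [quota_step] it survives one embedding step, and
[quota 0 = m ^ 2] exceeds the at most [d * m] vertices to be avoided when the
vertex itself is embedded. *)
Definition quota (k : nat) : nat := m ^ k.*2.+2.

Lemma quota_step k : m * (quota k).+1 <= quota k.+1.
Proof.
rewrite /quota doubleS [leqRHS]expnS leq_mul2l [X in _ || X](_ : _ = true) ?orbT //.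
have: 0 < m ^ k.*2.+2 by rewrite expn_gt0 ltnW.
by rewrite [m ^ _.+3]expnS; nia.
Qed.

Lemma quota_le k l : k <= l -> quota k <= quota l.
Proof. by move=> kl; rewrite leq_pexp2l ?ltnS ?leq_double // ltnW. Qed.

Definition partial_embedding S phi : Prop :=
  (forall x y, x \in S -> y \in S -> adj x y -> R x y (phi x) (phi y)) /\
  (forall w, w \notin S -> quota (rest S w) <= #|cand S phi w|).

Lemma rest_cons S u w : adj u w -> u \notin S ->
  rest S w = (rest (u |: S) w).+1.
Proof.
move=> uw uS; rewrite /rest (cardsD1 u) !inE uS adj_sym uw add1n.
by congr _.+1; apply: eq_card => x; rewrite !inE negb_or andbA.
Qed.

(** The image of [u] is any candidate that is poor for none of the at most [d]
unembedded neighbours of [u]. *)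
Lemma extend_embedding S phi u :
  u \notin S -> partial_embedding S phi ->
  exists phi', partial_embedding (u |: S) phi'.
Proof.
move=> uS [phiR phiC].
pose poor w := [set i | #|cand S phi w :&: nbrs u w i| < quota (rest (u |: S) w)].
pose bad := \bigcup_(w | adj u w && (w \notin S)) poor w.
have badC : #|bad| < #|cand S phi u|.
  apply: leq_trans (phiC u uS); apply: leq_trans (quota_le (leq0n _)).
  apply: (@leq_ltn_trans (d * m)); last first.
    by rewrite /quota /= expnS expn1 ltn_mul2r m_gtd andbT ltnW.
  apply: leq_trans (card_bigcup_le _ _) _.
  apply: (@leq_trans (\sum_(w | adj u w && (w \notin S)) m)).
    apply: leq_sum => w /andP[uw wS]; apply/ltnW/few_poor => //.
    apply: leq_trans (phiC w wS); rewrite (rest_cons uw uS); exact: quota_step.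
  rewrite sum_nat_const leq_mul2r; apply/orP; right.
  apply: leq_trans (deg_le u); rewrite /degree.
  by apply: subset_leq_card; apply/subsetP=> w; rewrite !inE => /andP[].
have /subsetPn[i iC ibad] : ~~ (cand S phi u \subset bad).
  by apply: contraL badC => /subset_leq_card; rewrite leqNgt.
exists (fun x => if x == u then i else phi x); split.
  have iR x : x \in S -> adj x u -> R x u (phi x) i.
    by move: iC; rewrite inE => /forall_inP iC xS xu; apply: (implyP (iC x xS)).
  move=> x y; rewrite !inE.
  have [->|xu] := eqVneq x u; have [->|yu] := eqVneq y u => //=.
  - by rewrite adj_irr.
  - by move=> _ yS uy; rewrite R_sym; apply: iR; rewrite // adj_sym.
  - by move=> xS _; apply: iR.
  - exact: phiR.
move=> w; rewrite inE negb_or inE => /andP[wu wS].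
have candE : cand (u |: S) (fun x => if x == u then i else phi x) w =
    cand S phi w :&: (if adj u w then nbrs u w i else setT).
  apply/setP=> j; rewrite !inE; apply/forall_inP/andP=> [jR|[/forall_inP jS jN] x].
    split; last first.
      by have := jR u (setU11 _ _); rewrite eqxx; case: ifP => _; rewrite ?inE.
    apply/forall_inP=> x xS; have := jR x (setU1r _ xS).
    by case: eqP xS uS => // -> ->.
  rewrite !inE; case: eqP => [-> _|_ /= xS]; last exact: jS.
  by apply/implyP=> uw; move: jN; rewrite uw inE.
rewrite candE; case: (boolP (adj u w)) => uw.
  rewrite leqNgt; apply: contra ibad => iw.
  by apply/bigcupP; exists w; rewrite ?uw ?wS // inE.
rewrite setIT; apply: leq_trans (phiC w wS); apply: quota_le.
by apply: subset_leq_card; apply: setDS; apply: subsetUr.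
Qed.

Lemma greedy_embedding : quota d <= #|K| ->
  exists phi : G -> K, forall x y, adj x y -> R x y (phi x) (phi y).
Proof.
move=> dK.
have [k0 _] : exists k0 : K, k0 \in K.
  apply/existsP; rewrite -[[exists _, _]]negbK negb_exists; apply/negP=> /forallP K0.
  move: dK; rewrite leqNgt => /negP[]; rewrite (eq_card0 (A := K)).
    by rewrite expn_gt0 ltnW.
  by move=> x; have := K0 x; rewrite inE.
suff [phi [phiR _]] : exists phi, partial_embedding [set x in enum G] phi.
  by exists phi => x y; apply: phiR; rewrite inE mem_enum.
elim: (enum G) => [|u s [phi IHs]].
  exists (fun=> k0); split=> [x y|w _]; first by rewrite inE.
  have -> : cand [set x in [::]] (fun=> k0) w = setT.
    by apply/setP=> j; rewrite !inE; apply/forall_inP=> x; rewrite inE.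
  rewrite cardsT; apply: leq_trans dK; apply: quota_le.
  by apply: leq_trans (deg_le w); apply: subset_leq_card; apply: subsetDl.
rewrite set_cons; have [us|us] := boolP (u \in [set x in s]).
  by exists phi; rewrite (setUidPr _) // sub1set.
exact: extend_embedding IHs.
Qed.

End GreedyEmbedding.

(** * The choice of constants *)

Lemma bin_le_exp n k : 'C(n, k) <= n ^ k.
Proof.
apply: (@leq_trans (n ^_ k)).
  by rewrite -bin_ffact leq_pmulr // fact_gt0.
elim: k => [|k IHk] //.
by rewrite ffactnSr expnSr leq_mul // leq_subr.
Qed.

(** For [m = 2 ^ (2 * q)] the left-hand side is at most [2] to a power of order
[q * d * m], so [m] only has to exceed a multiple of its logarithm. *)
Lemma scale_exists d : exists m,
  [/\ 1 < m, d < m &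
      2 * (('C(2 * quota m d, m)) * 'C(2 * quota m d, m)) < 2 ^ (m * m)].
Proof.
pose q := d + 4; pose m := 2 ^ (2 * q).
have q_lt : q < 2 ^ q by apply: ltn_expl.
have d_lt : 16 * d.+1 <= 2 ^ q by rewrite /q expnD mulnC leq_mul2r ltn_expl.
have mE : m = 2 ^ q * 2 ^ q by rewrite /m mul2n -addnn expnD.
have m_big : 8 * q * d.+1 + 3 <= m by rewrite mE; nia.
have m_gtd : d < m by rewrite mE; nia.
exists m; split=> //; first by lia.
have Ke : 2 * quota m d = 2 ^ (1 + 2 * q * d.*2.+2).
  by rewrite /quota /m -expnM expnD.
have binle : 'C(2 * quota m d, m) <= 2 ^ ((1 + 2 * q * d.*2.+2) * m).
  by rewrite [leqRHS]expnM -Ke; apply: bin_le_exp.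
apply: leq_ltn_trans (_ : 2 ^ (1 + (1 + 2 * q * d.*2.+2) * m * 2) < _).
  by rewrite expnD expn1 expnM leq_mul2l /= leq_mul.
rewrite ltn_exp2l //; move: m_big; rewrite -!mul2n.
by clear; nia.
Qed.

(** * The blown-up board *)

Lemma card_edges_le (H : sgraph) (D : nat) :
  (forall x : H, degree x <= D) -> #|edges H| <= #|H| * D.
Proof.
move=> degH; apply: leq_trans (leq_imset_card _ _) _.
apply: (@leq_trans (\sum_(x : H) \sum_(y | adj x y) 1)).
  by rewrite pair_big_dep /= sum1_card cardsE.
rewrite -sum_nat_const; apply: leq_sum => x _.
by rewrite sum1_card -cardsE; apply: degH.
Qed.

Section BlowUp.
Variables (G : sgraph) (K : nat).

Definition blowup_adj : rel (G * 'I_K) := fun x y => adj x.1 y.1.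

Lemma blowup_adj_sym : symmetric blowup_adj.
Proof. by move=> x y; apply: adj_sym. Qed.

Lemma blowup_adj_irr : irreflexive blowup_adj.
Proof. by move=> x; apply: adj_irr. Qed.

Definition blowup : sgraph := SGraph blowup_adj_sym blowup_adj_irr.

Lemma blowup_degree (x : blowup) : degree x = degree (x.1 : G) * K.
Proof.
rewrite /degree -[X in _ = _ * X]card_ord -cardsT -cardsX.
by apply: eq_card => y; rewrite !inE andbT.
Qed.

Lemma blowup_edges d :
  (forall u : G, degree u <= d) -> #|edges blowup| <= K * K * d * #|G|.
Proof.
move=> dG; have := @card_edges_le blowup (d * K).
rewrite card_prod card_ord => le_e.
apply: leq_trans (le_e _) _ => [x|]; last by nia.
by rewrite blowup_degree leq_mul2r dG orbT.
Qed.

Definition zone (e : {set blowup}) : {set G} := [set x.1 | x in e].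

Definition biclique (A B : {set blowup}) : {set {set blowup}} :=
  [set [set x; y] | x in A, y in B].

Lemma card_biclique (A B : {set blowup}) :
  [disjoint A & B] -> #|biclique A B| = #|A| * #|B|.
Proof.
move=> dAB; rewrite /biclique curry_imset2X card_in_imset ?cardsX //.
move=> [x y] [x' y'] /setXP[/= xA yB] /setXP[/= x'A y'B] exy.
have /set2P[ex|ex] : x \in [set x'; y'] by rewrite -exy set21.
  have /set2P[ey|ey] : y \in [set x'; y'] by rewrite -exy set22.
    by rewrite ey (disjointFr dAB x'A) in yB.
  by rewrite ex ey.
by rewrite -ex (disjointFr dAB xA) in y'B.
Qed.

Definition draws (m : nat) (z : {set G}) : {set {set blowup}} :=
  [set A : {set blowup} | A \subset setX z [set: 'I_K] & #|A| == m].

(** Zones are unordered pairs of vertices of [G], and a biclique over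
[z = {u, w}] is given by a set above [u] and a set above [w], in either order.
Both are drawn from the [2 * K] vertices above [z], which avoids orienting the
edges of [G] at the price of a cruder count. *)
Definition zone_bicliques (m : nat) (z : {set G}) : {set {set {set blowup}}} :=
  [set biclique P.1 P.2 | P in setX (draws m z) (draws m z) &
     (#|z| <= 2) &&
     [forall x in P.1, forall y in P.2, [set x.1; y.1] == z]].

Lemma zone_bicliqueP m z E e : E \in zone_bicliques m z -> e \in E -> zone e = z.
Proof.
case/imsetP=> -[A B] /=; rewrite inE /= => /and3P[_ _ /forall_inP zAB] ->.
case/imset2P=> x y xA yB ->; rewrite /zone imsetU1 imset_set1.
by apply/eqP; move/forall_inP: (zAB x xA); apply.
Qed.

Lemma card_zone_bicliques m z :
  #|zone_bicliques m z| <= 'C(2 * K, m) * 'C(2 * K, m).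
Proof.
have [z2|z2] := leqP #|z| 2; last first.
  rewrite (_ : zone_bicliques m z = set0) ?cards0 //; apply/setP=> E.
  rewrite inE; apply/imsetP=> -[P].
  by rewrite inE leqNgt z2 andbF.
apply: leq_trans (leq_imset_card _ _) _.
apply: (@leq_trans #|setX (draws m z) (draws m z)|).
  by apply: subset_leq_card; apply/subsetP=> P; rewrite inE => /andP[].
rewrite cardsX cards_draws cardsX cardsT card_ord.
by rewrite leq_mul // leq_bin2l // leq_mul2r z2 orbT.
Qed.

Lemma maker_hits_bicliques m :
  2 * ('C(2 * K, m) * 'C(2 * K, m)) < 2 ^ (m * m) ->
  exists2 s : seq {set blowup} -> {set blowup}, legal_maker_strategy s &
  forall p, is_complete_play p -> follows s p ->
  forall (u w : G) (A B : {set 'I_K}), adj u w -> #|A| = m -> #|B| = m ->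
  exists i j, [/\ i \in A, j \in B &
    [set (u, i); (w, j)] \in maker_edges (H := blowup) p].
Proof.
move=> m_small.
have F_small z : 2 * #|zone_bicliques m z| < 2 ^ (m * m).
  apply: leq_ltn_trans m_small; rewrite leq_mul2l /=.
  exact: card_zone_bicliques.
have [s s_legal s_hits] := maker_hits (@zone_bicliqueP m) F_small.
exists s => // p pc fp u w A B uw Am Bm.
pose A' : {set blowup} := [set (u, i) | i in A].
pose B' : {set blowup} := [set (w, j) | j in B].
have u_neq_w : u != w by apply: contraTneq uw => ->; rewrite adj_irr.
have A'm : #|A'| = m by rewrite card_imset // => i j [].
have B'm : #|B'| = m by rewrite card_imset // => i j [].
have dAB : [disjoint A' & B'].
  apply/pred0Pn=> -[x /andP[/imsetP[i _ ->] /imsetP[j _ [uw' _]]]].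
  by rewrite uw' eqxx in u_neq_w.
have ABF : biclique A' B' \in zone_bicliques m [set u; w].
  apply/imsetP; exists (A', B') => //=; rewrite !inE /= A'm B'm !eqxx !andbT /=.
  rewrite cards2 u_neq_w /=; rewrite -andbA; apply/and3P; split.
  - by apply/subsetP=> x /imsetP[i _ ->]; rewrite !inE eqxx.
  - by apply/subsetP=> x /imsetP[i _ ->]; rewrite !inE eqxx orbT.
  by apply/forall_inP=> x /imsetP[i _ ->]; apply/forall_inP=> y /imsetP[j _ ->].
have ABX : biclique A' B' \subset edges blowup.
  apply/subsetP=> e /imset2P[x y /imsetP[i _ ->] /imsetP[j _ ->] ->].
  by apply/imsetP; exists ((u, i), (w, j)); rewrite ?inE.
have [|e] := s_hits p pc fp _ _ ABF ABX.
  by rewrite card_biclique // A'm B'm.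
case/imset2P=> x y /imsetP[i iA ->] /imsetP[j jB ->] -> eM.
by exists i, j.
Qed.

End BlowUp.

Theorem theorem1p1 :
  forall d : nat, exists c : nat,
  forall (n : nat) (G : sgraph), #|G| = n -> max_degree G = d ->
  exists H : sgraph, #|edges H| <= c * n /\ maker_wins H G.
Proof.
move=> d; have [m [m_gt1 m_gtd m_small]] := scale_exists d.
exists (quota m d * quota m d * d) => n G Gn Gd.
have deg_le (u : G) : degree u <= d.
  by rewrite -Gd; apply: (leq_bigmax u).
exists (blowup G (quota m d)); split; first by rewrite -Gn; apply: blowup_edges.
have [s s_legal s_hits] := maker_hits_bicliques G m_small.
exists s => // p pc fp.
pose R (u w : G) (i j : 'I_(quota m d)) :=
  [set (u, i); (w, j)] \in maker_edges (H := blowup G (quota m d)) p.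
have R_sym u w i j : R u w i j = R w u j i by rewrite /R setUC.
have [|phi phiR] :=
    greedy_embedding R_sym (s_hits p pc fp) deg_le m_gt1 m_gtd.
  by rewrite card_ord.
exists (fun u => (u, phi u)) => [u w [] //|u w uw].
apply/andP; split; last exact: phiR.
by apply: contraTneq uw => -[-> _]; rewrite adj_irr.
Qed.
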